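(* Let $N \geq n \geq 1$ be integers and let $\boldsymbol{x} = (x_1,\ldots,x_N)$ be variables. Let $\lambda = (\lambda_1,\ldots,\lambda_n)$ and $\rho = (\rho_1,\ldots,\rho_n)$ be partitions such that $\lambda_i \leq \rho_i$ for every $i$ and $\lambda_i < \rho_i$ for at least one $i$. Then, for positive values of $x_1,\ldots,x_N$, the function $s_\lambda(\boldsymbol{x})/s_\rho(\boldsymbol{x})$ is strictly decreasing in each variable. More strongly, for each $j \in \{1,\ldots,N\}$, the partial derivative \[ \frac{\partial}{\partial x_j}\left(\frac{s_\lambda(\boldsymbol{x})}{s_\rho(\boldsymbol{x})}\right) \] can be expressed as a ratio of polynomials in which all coefficients of the denominator are nonnegative and all coefficients of the numerator are nonpositive.
   Context: A partition $\rho=(\rho_1,\ldots,\rho_n)$ is a weakly decreasing sequence of nonnegative integers (zero entries allowed; they do not affect the associated Schur polynomial). $s_\rho(\boldsymbol{x})$ denotes the Schur polynomial in $x_1,\ldots,x_N$, i.e. the sum of $\boldsymbol{x}^T$ over all semistandard Young tableaux $T$ of shape $\rho$ with entries in $\{1,\ldots,N\}$ (rows weakly increasing left to right, columns strictly increasing top to bottom), where $\boldsymbol{x}^T=\prod x_{T_{i,j}}$ over all boxes. *)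

(* Defs.v *)
From mathcomp Require Import all_boot all_order all_algebra.
From mathcomp Require Import mpoly.

Set Implicit Arguments.
Unset Strict Implicit.
Unset Printing Implicit Defensive.

Local Open Scope ring_scope.

Definition is_partition (n : nat) (rho : n.-tuple nat) : bool := sorted geq rho.

(* The Young diagram of rho: a box is a row i together with a column in
   {0, ..., rho_i - 1}; rows of length zero contribute no box. *)
Definition box (n : nat) (rho : n.-tuple nat) : finType :=
  {i : 'I_n & 'I_(tnth rho i)}.

Definition box_row (n : nat) (rho : n.-tuple nat) (b : box rho) : nat := tag b.

Definition box_col (n : nat) (rho : n.-tuple nat) (b : box rho) : nat :=
  tagged b.

(* The entries {1, ..., N} are represented by 'I_N = {0, ..., N - 1}. *)
Definition is_ssyt (n N : nat) (rho : n.-tuple nat)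
    (T : {ffun box rho -> 'I_N}) : bool :=
  [forall b : box rho, forall c : box rho,
     ((box_row b == box_row c) && (box_col b < box_col c) ==> (T b <= T c))
     && ((box_col b == box_col c) && (box_row b < box_row c) ==> (T b < T c))]%N.

Definition schur (R : comNzRingType) (n N : nat) (rho : n.-tuple nat) :
    {mpoly R[N]} :=
  \sum_(T : {ffun box rho -> 'I_N} | is_ssyt T) \prod_(b : box rho) 'X_(T b).

Arguments schur R {n} N rho.

(* The point x with its j-th coordinate replaced by t. *)
Definition setcoord (R : Type) (N : nat) (x : 'I_N -> R) (j : 'I_N) (t : R) :
    'I_N -> R := fun i => if i == j then t else x i.

Definition schur_ratio (R : fieldType) (n N : nat) (lambda rho : n.-tuple nat)
    (x : 'I_N -> R) : R :=
  (schur R N lambda).@[x] / (schur R N rho).@[x].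

(* Main.v *)
Require Import Defs.
From mathcomp Require Import all_boot all_order all_fingroup all_algebra.
From mathcomp Require Import mpoly.
From mathcomp Require Import zify ring.
From mathcomp Require Import boolp functions reals topology normedtype derive realfun.
Import Order.TTheory GRing.Theory Num.Theory.
Import numFieldNormedType.Exports.

(* Proof idea.  Let W_j = s_rho d_j s_lambda - s_lambda d_j s_rho, the numerator of
   the derivative over the denominator s_rho^2.  Tableaux are encoded as
   Gelfand-Tsetlin patterns, on which Bender-Knuth involutions are reflections of
   one level; hence Schur polynomials are symmetric and all the W_j are obtained
   from W_1 by permuting variables.  The coefficient of a monomial in x_1 W_1 is
   the sum of c(P) - c(Q), c counting the entries 1, over the pairs (P, Q) of
   patterns of shapes lambda and rho with that total content.  When c(P) > c(Q),
   exchange P and Q on the smallest set of positions that contains the one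
   recording c and keeps both patterns valid (cell transfer of Lam and
   Pylyavskyy).  There P > Q, so the set avoids the top level, where
   lambda <= rho, and both shapes are preserved.  The exchange is an involution
   that changes the sign of c(P) - c(Q), so the positive terms cancel.  Finally
   W_1 <> 0, as Euler's identity gives
   sum_j x_j W_j = (|lambda| - |rho|) s_lambda s_rho. *)

Set Implicit Arguments.
Unset Strict Implicit.
Unset Printing Implicit Defensive.
Local Open Scope ring_scope.

(** * Exchanging two monotone functions on a connected component *)

Section Swap.

Variables (V : finType) (E : rel V) (v0 : V) (m : nat).
Implicit Types P Q : {ffun V -> 'I_m}.
Local Open Scope nat_scope.

Definition monotone P : bool := [forall a, forall b, E a b ==> (P a <= P b)].

Lemma monotoneP P : reflect (forall a b, E a b -> P a <= P b) (monotone P).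
Proof.
apply: (iffP forallP) => [H a b Eab|H a].
  by move/forallP/(_ b)/implyP: (H a); apply.
by apply/forallP => b; apply/implyP; apply: H.
Qed.

(* Two E-neighbours are bonded when exchanging the values of P and Q at exactly
   one of them would break monotonicity. *)
Definition bond P Q : rel V := fun a b =>
  (E a b && ~~ ((P a <= Q b) && (Q a <= P b)))
  || (E b a && ~~ ((P b <= Q a) && (Q b <= P a))).

Definition bonded P Q : pred V := connect (bond P Q) v0.

Definition swap P Q : {ffun V -> 'I_m} :=
  [ffun v => if bonded P Q v then Q v else P v].

Lemma bondC P Q : bond Q P =2 bond P Q.
Proof. by move=> a b; rewrite /bond; congr (_ && ~~ _ || _ && ~~ _); apply: andbC. Qed.

Lemma bondedC P Q : bonded Q P =1 bonded P Q.
Proof. exact: (eq_connect (bondC P Q)). Qed.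

Lemma bond_sym P Q a b : bond P Q a b = bond P Q b a.
Proof. by rewrite /bond orbC; congr (_ && ~~ _ || _ && ~~ _). Qed.

Lemma bonded_step P Q a b : bond P Q a b -> bonded P Q a = bonded P Q b.
Proof.
move=> ab; apply/idP/idP => H; apply: (connect_trans H (connect1 _)) => //.
by rewrite bond_sym.
Qed.

Lemma bondedPn P Q a b : bonded P Q a != bonded P Q b -> E a b ->
  (P a <= Q b) && (Q a <= P b).
Proof.
move=> nab Eab; apply: contraNT nab => nle; apply/eqP/bonded_step.
by rewrite /bond Eab nle.
Qed.

(** An edge between the component and its complement is not a bond, so both mixed inequalities hold
    on it; on any other edge the result copies [P] alone or [Q] alone. *)
Lemma swap_monotone P Q : monotone P -> monotone Q -> monotone (swap P Q).
Proof.
move=> /monotoneP mP /monotoneP mQ; apply/monotoneP => a b Eab; rewrite !ffunE.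
have := @bondedPn P Q a b; case: (bonded P Q a); case: (bonded P Q b) => /= H.
- exact: mQ.
- by have /andP[] := H isT Eab.
- by have /andP[] := H isT Eab.
- exact: mP.
Qed.

(* Bonds are symmetric in P and Q, and none joins the component of v0 to its
   complement, before or after the exchange. *)
Lemma bond_swap P Q : monotone P -> monotone Q ->
  bond (swap P Q) (swap Q P) =2 bond P Q.
Proof.
move=> /monotoneP mP /monotoneP mQ a b.
have [ab|nab] := eqVneq (bonded P Q a) (bonded P Q b).
  have [bs|bs] := boolP (bonded P Q b); move: ab; rewrite ?bs ?(negbTE bs) => ab.
    by rewrite -[RHS]bondC /bond !ffunE !(bondedC P Q) ab bs.
  by rewrite /bond !ffunE !(bondedC P Q) ab (negbTE bs).
have -> : bond P Q a b = false.
  by apply: contraNF nab => bnd; apply/eqP/bonded_step.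
rewrite /bond !ffunE !(bondedC P Q).
have noviol (e p : bool) : (e -> p) -> e && ~~ p = false by case: e => //= ->.
by case: (bonded P Q a) nab; case: (bonded P Q b) => // _;
  rewrite !noviol // => Eab; rewrite ?(mP _ _ Eab) ?(mQ _ _ Eab).
Qed.

(** By [bond_swap] the component is the same after the exchange, so the second exchange undoes the
    first. *)
Lemma swapK P Q : monotone P -> monotone Q -> swap (swap P Q) (swap Q P) = P.
Proof.
move=> mP mQ; apply/ffunP => v; rewrite !ffunE (bondedC P Q).
rewrite [bonded (swap _ _) _ v](eq_connect (bond_swap mP mQ)).
by rewrite -/(bonded P Q v); case: (bonded P Q v).
Qed.

Lemma swap_add P Q v : swap P Q v + swap Q P v = P v + Q v.
Proof. by rewrite !ffunE bondedC; case: ifP => // _; rewrite addnC. Qed.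

Lemma swap_root P Q : swap P Q v0 = Q v0.
Proof. by rewrite ffunE /bonded connect0. Qed.

(** The strict inequality propagates along a bond from [b] to [a]: monotonicity and [Q b < P b] give
    one of the two mixed inequalities, so the other fails, and monotonicity turns this failure into
    [Q a < P a]. *)
Lemma bonded_gt P Q v : monotone P -> monotone Q -> Q v0 < P v0 ->
  bonded P Q v -> Q v < P v.
Proof.
move=> /monotoneP mP /monotoneP mQ lt0 /connectP[p]; elim/last_ind: p v => [|p a IH] v /=.
  by move=> _ ->.
rewrite rcons_path last_rcons => /andP[pth bnd] ->.
have {IH pth} := IH _ pth erefl; move: (last v0 p) bnd => b.
rewrite /bond => /orP[] /andP[Eab]; have := mP _ _ Eab; have := mQ _ _ Eab; lia.
Qed.

(** This is what freezes the bottom and top levels of patterns during the exchange. *)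
Lemma swap_fixed P Q v : monotone P -> monotone Q -> Q v0 < P v0 -> P v <= Q v ->
  swap P Q v = P v.
Proof.
move=> mP mQ lt0 le; rewrite ffunE; case: ifP => // /(bonded_gt mP mQ lt0).
by rewrite ltnNge le.
Qed.

End Swap.

(* [G i r] is the number of entries smaller than [i] in row [r] of a tableau;
   rows beyond the last one are empty. *)
Record is_pattern (N n : nat) (rho : nat -> nat) (G : nat -> nat -> nat) : Prop :=
  IsPattern {
    pattern0 : forall r, G 0%N r = 0%N;
    patternN : forall r, G N r = rho r;
    pattern_out : forall i r, (n <= r)%N -> G i r = 0%N;
    pattern_le : forall i r, (i < N)%N -> (G i r <= G i.+1 r)%N;
    pattern_interlace : forall i r, (i < N)%N -> (G i.+1 r.+1 <= G i r)%N }.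

(** * Bender-Knuth involutions on Gelfand-Tsetlin patterns *)

Section Toggle.

Local Open Scope nat_scope.
Variables (N n : nat) (rho : nat -> nat) (k : nat).
Hypothesis kN : k.+1 < N.
Implicit Type G : nat -> nat -> nat.

(** Row 0 has no row above it, so only level [k.+2] bounds it from above. *)
Definition toggle_max G r :=
  if r is r'.+1 then minn (G k.+2 r) (G k r') else G k.+2 0.

Arguments toggle_max : simpl never.

Definition toggle_min G r := maxn (G k.+2 r.+1) (G k r).

(* The Bender-Knuth involution: each value of level [k.+1] is reflected in the
   interval allowed by the levels [k] and [k.+2]. *)
Definition toggle G i r :=
  if i == k.+1 then toggle_max G r + toggle_min G r - G k.+1 r else G i r.

(** This makes the truncated subtraction in [toggle] a true reflection. *)
Lemma toggle_range G r : is_pattern N n rho G ->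
  toggle_min G r <= G k.+1 r <= toggle_max G r.
Proof.
move=> [_ _ _ le il]; rewrite /toggle_min /toggle_max.
have := le k r; have := il k r; have := le k.+1 r; have := il k.+1 r.
case: r => [|r]; first lia.
have := il k r; lia.
Qed.

Lemma toggle_pattern G : is_pattern N n rho G -> is_pattern N n rho (toggle G).
Proof.
move=> pG; have rg r := toggle_range r pG; case: pG => [p0 pN po le il].
have mx r : (toggle_max G r <= G k.+2 r) && (toggle_max G r.+1 <= G k r).
  by rewrite /toggle_max geq_minr; case: r => [|r]; rewrite ?geq_minl ?leqnn.
have mn r : (G k.+2 r.+1 <= toggle_min G r) && (G k r <= toggle_min G r).
  by rewrite leq_maxl leq_maxr.
rewrite /toggle; split.
- by move=> r; rewrite p0.
- by move=> r; case: eqP => [?|]; [lia|rewrite pN].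
- move=> i r nr; case: eqP => _; last exact: po.
  have := rg r; rewrite (po k.+1 r nr) /toggle_max /toggle_min.
  by case: r nr => [|r] nr; rewrite ?(po _ _ nr) ?(po _ r.+2) //;
    have := po k.+2 1; have := po k 0; lia.
- move=> i r iN; case: (i =P _) => ik; case: (i.+1 =P _) => ik'; last exact: le.
  + lia.
  + by rewrite ik; have := rg r; have := mx r; lia.
  + by case: ik' => ->; have := rg r; have := mn r; lia.
- move=> i r iN; case: (i =P _) => ik; case: (i.+1 =P _) => ik'; last exact: il.
  + lia.
  + by rewrite ik; have := rg r; have := mn r; lia.
  + by case: ik' => ->; have := rg r.+1; have := mx r; lia.
Qed.

Lemma toggleK G i r : is_pattern N n rho G -> toggle (toggle G) i r = G i r.
Proof.
move=> pG; rewrite {1}/toggle; case: eqP => [->|/eqP/negbTE nik]; last by rewrite /toggle nik.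
have -> : toggle_max (toggle G) r = toggle_max G r.
  by case: r => [|r]; rewrite /toggle_max /toggle; do !case: eqP => //; lia.
have -> : toggle_min (toggle G) r = toggle_min G r.
  by rewrite /toggle_min /toggle; do !case: eqP => //; lia.
by rewrite /toggle eqxx; have := toggle_range r pG; lia.
Qed.

(** The sum of the interval ends telescopes: [toggle_min] of row [r] and [toggle_max] of row [r.+1]
    are the maximum and the minimum of the same two numbers. *)
Lemma toggle_sum G : is_pattern N n rho G ->
  \sum_(r < n) toggle G k.+1 r + \sum_(r < n) G k.+1 r =
  \sum_(r < n) G k.+2 r + \sum_(r < n) G k r.
Proof.
move=> pG.
have part t : \sum_(r < t) (toggle_max G r + toggle_min G r) + toggle_max G t =
              \sum_(r < t) G k.+2 r + \sum_(r < t) G k r + G k.+2 t.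
  elim: t => [|t IH]; first by rewrite !big_ord0.
  rewrite !big_ord_recr /=.
  have : toggle_min G t + toggle_max G t.+1 = G k.+2 t.+1 + G k t.
    by rewrite /toggle_min /toggle_max; lia.
  move: IH; set u := \sum_(r < t) _; set v := \sum_(r < t) _; set w := \sum_(r < t) _.
  by lia.
have := part n; rewrite (pattern_out pG _ (leqnn n)) addn0.
have -> : toggle_max G n = 0.
  rewrite /toggle_max; have := pattern_out pG k.+2 (leqnn n).
  by case: (n) => //= ? ->; rewrite min0n.
rewrite addn0 => <-; rewrite -big_split /=; apply: eq_bigr => r _.
by rewrite /toggle eqxx; have := toggle_range r pG; lia.
Qed.

End Toggle.

(** * The bijection between semistandard tableaux and patterns *)

(** An initial segment is determined by its size, which lets counts encode the rows of a tableau. *)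
Lemma card_initial (t : nat) (p : pred 'I_t) :
  (forall a b : 'I_t, (a <= b)%N -> p b -> p a) ->
  forall c : 'I_t, (c < #|p|)%N = p c.
Proof.
move=> p_down c.
have card_lt k : (k <= t)%N -> #|[pred a : 'I_t | (a < k)%N]| = k.
  by move=> kt; rewrite -sum1_card (big_ord_narrow kt) /= sum1_card card_ord.
apply/idP/idP => [|pc]; last first.
  rewrite -[X in (X <= _)%N](card_lt c.+1) //; apply: subset_leq_card.
  by apply/subsetP => a; rewrite !inE ltnS => ac; apply: p_down pc.
apply: contraLR => npc; rewrite -leqNgt -[X in (_ <= X)%N](card_lt c (ltnW (ltn_ord c))).
apply: subset_leq_card; apply/subsetP => a; rewrite !inE => pa.
by rewrite ltnNge; apply: contra npc => ca; apply: p_down pa.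
Qed.

Section Patterns.

Variables (K n M : nat).
Local Notation pat := {ffun 'I_K.+2 * 'I_n -> 'I_M.+1}.
Implicit Types (g : pat) (rho : n.-tuple nat).

(** With [K.+1] variables the levels run from 0 to [K.+1]. The default 0 outside the range agrees
    with the empty rows of [is_pattern]. *)
Definition value g (i r : nat) : nat :=
  if insub i is Some i' then if insub r is Some r' then g (i', r') else 0%N
  else 0%N.

Lemma valueE g (i : 'I_K.+2) (r : 'I_n) : value g i r = g (i, r).
Proof. by rewrite /value !valK. Qed.

Lemma value_nat g i r (hi : (i < K.+2)%N) (hr : (r < n)%N) :
  value g i r = g (Ordinal hi, Ordinal hr).
Proof. exact: (valueE g (Ordinal hi) (Ordinal hr)). Qed.

Lemma value_out g i r : (n <= r)%N -> value g i r = 0%N.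
Proof.
by move=> nr; rewrite /value; case: insubP => //= i' _ _; rewrite insubN // -leqNgt.
Qed.

Definition mkpat (G : nat -> nat -> nat) : pat :=
  [ffun u : 'I_K.+2 * 'I_n => inord (G u.1 u.2)].

Lemma value_mkpat G i r : (i < K.+2)%N -> (r < n)%N -> (G i r <= M)%N ->
  value (mkpat G) i r = G i r.
Proof. by move=> hi hr GM; rewrite (value_nat _ hi hr) ffunE inordK. Qed.

Lemma value_inj g h :
  (forall i r, (i < K.+2)%N -> (r < n)%N -> value g i r = value h i r) -> g = h.
Proof.
move=> gh; apply/ffunP => -[i r]; apply: val_inj => /=.
by rewrite -!valueE gh.
Qed.

(** The two families of interlacing inequalities form one relation, so that the exchange of monotone
    functions applies to patterns. *)
Definition pat_rel : rel ('I_K.+2 * 'I_n) := fun u v =>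
  ((v.1 == u.1.+1 :> nat) && (u.2 == v.2))
  || ((u.1 == v.1.+1 :> nat) && (u.2 == v.2.+1 :> nat)).

Definition pattern rho g : bool :=
  monotone pat_rel g
  && [forall r : 'I_n, (g (ord0, r) == 0%N :> nat) && (g (ord_max, r) == tnth rho r :> nat)].

Lemma patternP rho g :
  reflect (is_pattern K.+1 n (nth 0%N rho) (value g)) (pattern rho g).
Proof.
apply: (iffP andP) => [[/monotoneP mg /forallP bd]|[p0 pN po le il]]; last first.
  split; last first.
    apply/forallP => r; rewrite -!valueE /= p0 eqxx.
    by rewrite pN (tnth_nth 0%N) eqxx.
  apply/monotoneP => -[i r] [i' r']; rewrite -!valueE /pat_rel /=.
  move=> /orP[] /andP[/eqP E /eqP E']; rewrite E E'.
    by apply: le; rewrite -ltnS -E.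
  by apply: il; rewrite -ltnS -E.
have hN : (K.+1 < K.+2)%N by [].
split.
- move=> r; have [hr|/value_out->//] := ltnP r n.
  rewrite (value_nat g (ltn0Sn _) hr).
  have /andP[/eqP b0 _] := bd (Ordinal hr); rewrite -[RHS]b0.
  by congr (nat_of_ord (g (_, _))); apply: val_inj.
- move=> r; have [hr|hr] := ltnP r n; last by rewrite value_out // nth_default // size_tuple.
  have /andP[_ /eqP] := bd (Ordinal hr); rewrite (tnth_nth 0%N) /= => <-.
  by rewrite (value_nat g hN hr); congr (nat_of_ord (g (_, _))); apply: val_inj.
- exact: value_out.
- move=> i r hi; have [hr|/value_out->//] := ltnP r n.
  have hi' : (i.+1 < K.+2)%N by [].
  rewrite (value_nat g (ltnW hi') hr) (value_nat g hi' hr); apply: mg.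
  by rewrite /pat_rel /= !eqxx.
- move=> i r hi; have [hr|/value_out->//] := ltnP r.+1 n.
  have hi' : (i.+1 < K.+2)%N by [].
  rewrite (value_nat g hi' hr) (value_nat g (ltnW hi') (ltnW hr)); apply: mg.
  by rewrite /pat_rel /= !eqxx orbT.
Qed.

Lemma is_pattern_bound N f G i r : is_pattern N n f G -> (i <= N)%N ->
  (G i r <= f r)%N.
Proof.
move=> pG; rewrite -(patternN pG); elim: N {pG}(pattern_le pG) => [|N IH] le.
  by rewrite leqn0 => /eqP ->.
rewrite leq_eqVlt => /orP[/eqP->//|]; rewrite ltnS => iN.
by apply: leq_trans (le N r (ltnSn _)); apply: IH => // j s jN; apply: le; apply: ltnW.
Qed.

Lemma is_pattern_rows N f G i r r' : is_pattern N n f G -> (i < N)%N ->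
  (r < r')%N -> (G i.+1 r' <= G i r)%N.
Proof.
move=> pG iN; elim: r' => // r' IH; rewrite ltnS leq_eqVlt => /orP[/eqP->|rr'].
  exact: pattern_interlace pG _ _ iN.
apply: leq_trans (IH rr'); apply: leq_trans (pattern_interlace pG r' iN) _.
exact (pattern_le pG r' iN).
Qed.

Definition level g i := (\sum_(r < n) value g i r)%N.

(** Level [i] counts the entries smaller than [i], so consecutive differences count the entries
    equal to [i]. *)
Definition content g : 'X_{1..K.+1} := [multinom (level g i.+1 - level g i)%N | i < K.+1].

Lemma level_le rho g i : pattern rho g -> (i < K.+1)%N -> (level g i <= level g i.+1)%N.
Proof. by move=> /patternP pg iK; apply: leq_sum => r _; exact (pattern_le pg r iK). Qed.

Section Bijection.

Variable rho : n.-tuple nat.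
Hypothesis rho_part : is_partition rho.
Hypothesis rhoM : forall r, (tnth rho r <= M)%N.

Definition pattern_of (T : {ffun box rho -> 'I_K.+1}) : pat :=
  [ffun u : 'I_K.+2 * 'I_n =>
     inord #|[pred c : 'I_(tnth rho u.2) |
               (T (Tagged (fun r => 'I_(tnth rho r)) c) < u.1)%N]|].

(* Inverse to [pattern_of]: T(r, c) < i if and only if c < g(i, r). *)
Definition tableau_of g : {ffun box rho -> 'I_K.+1} :=
  [ffun b : box rho =>
     inord #|[pred i : 'I_K.+1 | (g (lift ord0 i, tag b) <= tagged b)%N]|].

Local Notation bx c := (Tagged (fun r => 'I_(tnth rho r)) c).

Lemma is_ssytP (T : {ffun box rho -> 'I_K.+1}) :
  reflect ((forall r (c c' : 'I_(tnth rho r)), (c <= c')%N -> (T (bx c) <= T (bx c'))%N)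
           /\ (forall r r' (c : 'I_(tnth rho r)) (c' : 'I_(tnth rho r')),
                 (r < r')%N -> c = c' :> nat -> (T (bx c) < T (bx c'))%N))
          (is_ssyt T).
Proof.
apply: (iffP forallP) => [H|[row col] [r c]].
  split=> [r c c'|r r' c c' rr' cc'].
    rewrite leq_eqVlt => /orP[/eqP/val_inj->//|cc'].
    have /forallP/(_ (bx c'))/andP[/implyP h _] := H (bx c).
    by apply: h; rewrite /box_row /box_col /= eqxx.
  have /forallP/(_ (bx c'))/andP[_ /implyP h] := H (bx c).
  by apply: h; rewrite /box_row /box_col /= cc' eqxx.
apply/forallP => -[r' c']; rewrite /box_row /box_col /=; apply/andP; split.
  apply/implyP => /andP[/eqP/val_inj rr'] lt_cc'; case: r' / rr' c' lt_cc' => c' lt_cc'.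
  exact/row/ltnW.
by apply/implyP => /andP[/eqP cc' rr']; apply: col.
Qed.

Lemma partition_le (r r' : 'I_n) : (r <= r')%N -> (tnth rho r' <= tnth rho r)%N.
Proof.
move=> rr'; rewrite !(tnth_nth 0%N).
have geq_tr : transitive geq by move=> b a c ab bc; apply: leq_trans bc ab.
by apply: (sorted_leq_nth geq_tr leqnn 0%N rho_part); rewrite ?inE ?size_tuple.
Qed.

(** Rows increase weakly, so the boxes of a row with entry below [i] form an initial segment. *)
Lemma pattern_of_gt (T : {ffun box rho -> 'I_K.+1}) : is_ssyt T ->
  forall (i : 'I_K.+2) r (c : 'I_(tnth rho r)),
  (c < pattern_of T (i, r))%N = (T (bx c) < i)%N.
Proof.
move=> /is_ssytP[row _] i r c; rewrite ffunE /= inordK.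
  rewrite (@card_initial _ [pred c : 'I_(tnth rho r) | (T (bx c) < i)%N]) //.
  by move=> a b ab /=; apply: leq_ltn_trans; apply: row.
by rewrite ltnS (leq_trans (max_card _)) // card_ord.
Qed.

Lemma pattern_of_le (T : {ffun box rho -> 'I_K.+1}) u :
  (pattern_of T u <= tnth rho u.2)%N.
Proof.
rewrite ffunE inordK; first by rewrite (leq_trans (max_card _)) ?card_ord.
by rewrite ltnS (leq_trans (max_card _)) // card_ord.
Qed.

(** Levels increase with [i], so the counted indices form an initial segment. The shift by
    [lift ord0] appears because [i < T(r, c)] means that column [c] lies beyond all entries smaller
    than [i.+1]. *)
Lemma tableau_of_le g : pattern rho g ->
  forall r (c : 'I_(tnth rho r)) (i : 'I_K.+1),
  (i < tableau_of g (bx c))%N = (g (lift ord0 i, r) <= c)%N.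
Proof.
move=> /patternP pg r c i; rewrite ffunE /=.
pose p := [pred i : 'I_K.+1 | (g (lift ord0 i, r) <= c)%N].
have down (a b : 'I_K.+1) : (a <= b)%N -> p b -> p a.
  rewrite /p /= -!valueE /=; move=> ab; apply: leq_trans.
  rewrite /bump /= !add1n; have := ltn_ord b; move: (nat_of_ord b) ab => b'.
  elim: b' => [|b' IH]; first by rewrite leqn0 => /eqP->.
  rewrite leq_eqVlt => /orP[/eqP->//|ab] bK.
  apply: leq_trans (IH ab (ltnW bK)) _; exact (pattern_le pg r bK).
rewrite inordK; first by rewrite card_initial.
(* If all [K.+1] indices were counted, so would be the top level, forcing [rho_r <= c]. *)
rewrite ltnNge; apply/negP => full.
have := card_initial down ord_max; rewrite full => /esym.
rewrite /p /= -valueE lift0 (patternN pg) -tnth_nth.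
by rewrite leqNgt ltn_ord.
Qed.

Lemma pattern_ofP (T : {ffun box rho -> 'I_K.+1}) : is_ssyt T ->
  pattern rho (pattern_of T).
Proof.
move=> Tss; have gt := pattern_of_gt Tss; have [row col] := is_ssytP _ Tss.
have le_by (u v : 'I_K.+2 * 'I_n) : (forall c : 'I_(tnth rho u.2),
    (c < pattern_of T u)%N -> (c < pattern_of T v)%N) ->
    (pattern_of T u <= pattern_of T v)%N.
  move=> H; rewrite leqNgt; apply/negP => lt.
  have lt' := leq_trans lt (pattern_of_le T u).
  by have := H (Ordinal lt') lt; rewrite ltnn.
apply/andP; split.
  apply/monotoneP => -[i r] [i' r'] /= /orP[] /andP[/eqP /= E /eqP /= E'].
    case: r' / E'; apply: le_by => c; rewrite !gt E.
    exact: ltnW.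
  (* The box above exists because [rho] is a partition, and column strictness makes its entry
     smaller by at least one, which pays for the drop of one level. *)
  apply: le_by => /= c; have cr' : (c < tnth rho r')%N.
    by apply: leq_trans (ltn_ord c) (partition_le _); rewrite E'.
  rewrite gt E ltnS => Tc; rewrite -[X in (X < _)%N]/(nat_of_ord (Ordinal cr')) gt.
  by apply: leq_trans Tc; apply: col; rewrite ?E'.
apply/forallP => r; apply/andP; split.
  by rewrite -leqn0 leqNgt; apply/negP => lt; have lt' := leq_trans lt (pattern_of_le T _);
    have := gt ord0 r (Ordinal lt'); rewrite /= lt.
rewrite eqn_leq pattern_of_le /= leqNgt; apply/negP => lt.
by have := gt ord_max r (Ordinal lt); rewrite /= ltnn ltn_ord.
Qed.

Lemma tableau_ofP g : pattern rho g -> is_ssyt (tableau_of g).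
Proof.
move=> pg; have tle := tableau_of_le pg; have /patternP pg' := pg.
have le_by b (x : nat) : (x <= K.+1)%N ->
    (forall i : 'I_K.+1, (i < x)%N -> (i < tableau_of g b)%N) ->
    (x <= tableau_of g b)%N.
  move=> xK H; rewrite leqNgt; apply/negP => lt.
  by have := H _ lt; rewrite ltnn.
apply/is_ssytP; split.
  move=> r c c' cc'; apply: le_by => [|i]; first exact/ltnW.
  by rewrite !tle => /leq_trans; apply.
move=> r r' c c' rr' cc'; apply: le_by => // i.
(* For [i = 0], level 1 vanishes below row 0 by interlacing with the zero level; otherwise
   interlacing compares level [i.+1] of the lower row with level [i] of the upper one. *)
case: i => -[|i] iK /=; rewrite ltnS => iT.
  rewrite (tle r' c' (Ordinal iK)) -valueE lift0.
  by apply: leq_trans (is_pattern_rows pg' _ rr') _; rewrite // (pattern0 pg').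
have := tle r c (Ordinal (ltnW iK)); rewrite /= iT => /esym.
rewrite (tle r' c' (Ordinal iK)) -!valueE !lift0 -cc' => H.
by apply: leq_trans H; exact: (is_pattern_rows pg' iK rr').
Qed.

Lemma pattern_ofK (T : {ffun box rho -> 'I_K.+1}) : is_ssyt T ->
  tableau_of (pattern_of T) = T.
Proof.
move=> Tss; have gt := pattern_of_gt Tss.
have tle := tableau_of_le (pattern_ofP Tss).
apply/ffunP => -[r c]; rewrite -/(bx c).
have E (i : 'I_K.+1) : (i < tableau_of (pattern_of T) (bx c))%N = (i < T (bx c))%N.
  rewrite (tle r c i) [LHS]leqNgt (gt (lift ord0 i) r c) -[LHS]leqNgt.
  by rewrite lift0.
move: (T (bx c)) (tableau_of _ _) E => x y E.
apply: val_inj; apply/eqP; rewrite eqn_leq leqNgt [X in _ && X]leqNgt.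
apply/andP; split; apply/negP => lt.
  by have := E x; rewrite lt ltnn.
by have := E y; rewrite lt ltnn.
Qed.

Lemma tableau_ofK g : pattern rho g -> pattern_of (tableau_of g) = g.
Proof.
move=> pg; have gt := pattern_of_gt (tableau_ofP pg); have tle := tableau_of_le pg.
have /patternP pg' := pg.
have gle u : (g u <= tnth rho u.2)%N.
  case: u => i r /=; rewrite -valueE (tnth_nth 0%N).
  by apply: is_pattern_bound pg' _; rewrite -ltnS.
have E i r (c : 'I_(tnth rho r)) : (c < pattern_of (tableau_of g) (i, r))%N = (c < g (i, r))%N.
  rewrite gt -valueE; case: i => -[|i] hi /=; first by rewrite (pattern0 pg').
  have := tle r c (Ordinal (hi : (i < K.+1)%N)).
  rewrite -valueE lift0 ltnS => h; rewrite leqNgt h -ltnNge //.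
apply/ffunP => -[i r]; apply: val_inj; apply/eqP; rewrite eqn_leq leqNgt [X in _ && X]leqNgt.
apply/andP; split; apply/negP => lt.
  have lt' := leq_trans lt (pattern_of_le _ _).
  by have := E i r (Ordinal lt'); rewrite /= lt ltnn.
have lt' := leq_trans lt (gle _).
by have := E i r (Ordinal lt'); rewrite /= lt ltnn.
Qed.

Lemma level_pattern_of (T : {ffun box rho -> 'I_K.+1}) (i : 'I_K.+2) :
  level (pattern_of T) i = (\sum_(b : box rho) (T b < i)%N)%N.
Proof.
rewrite /level (eq_bigr (fun r => \sum_(c < tnth rho r) (T (bx c) < i)%N)%N); last first.
  move=> r _; rewrite valueE ffunE /= inordK ?sum1dep_card.
    by rewrite -sum1_card big_mkcond.
  by rewrite ltnS (leq_trans (max_card _)) // card_ord.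
by rewrite sig_big_dep; apply: eq_bigr => -[r c] _.
Qed.

Lemma content_pattern_of (T : {ffun box rho -> 'I_K.+1}) :
  content (pattern_of T) = (\sum_(b : box rho) U_(T b))%MM.
Proof.
apply/mnmP => i; rewrite mnmE mnm_sumE.
have := level_pattern_of T (lift ord0 i); rewrite lift0 => ->.
have := level_pattern_of T (widen_ord (leqnSn _) i); rewrite /= => ->.
rewrite -sumnB; last by move=> b _; case: ltnP => // /ltnW; rewrite ltnS => ->.
apply: eq_bigr => b _; rewrite mnm1E -val_eqE /= ltnS.
by case: ltngtP.
Qed.

Lemma schur_monomials (R : comNzRingType) :
  schur R K.+1 rho = \sum_(T : {ffun box rho -> 'I_K.+1} | is_ssyt T)
                       'X_[(\sum_(b : box rho) U_(T b))%MM].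
Proof.
by apply: eq_bigr => T _; rewrite (big_morph _ (@mpolyXD _ R) (mpolyX0 _ R)).
Qed.

Lemma schur_patterns (R : comNzRingType) :
  schur R K.+1 rho = \sum_(g | pattern rho g) 'X_[content g].
Proof.
rewrite schur_monomials (reindex_onto tableau_of pattern_of); last exact: pattern_ofK.
apply: eq_big => [g|g /andP[Tss /eqP gK]].
  apply/andP/idP => [[Tss /eqP <-]|pg]; first exact: pattern_ofP.
  by rewrite tableau_ofP // tableau_ofK.
by rewrite -[in RHS]gK content_pattern_of.
Qed.

End Bijection.
End Patterns.

(** * Symmetry of Schur polynomials *)

Section Symmetry.

Variables (K n : nat) (rho : n.-tuple nat).
Hypothesis rho_part : is_partition rho.
Variable M : nat.
Hypothesis rhoM : forall r, (tnth rho r <= M)%N.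
Local Notation pat := {ffun 'I_K.+2 * 'I_n -> 'I_M.+1}.
Implicit Type g : pat.

Lemma nth_bound r : (nth 0%N rho r <= M)%N.
Proof.
have [rn|nr] := ltnP r n; last by rewrite nth_default // size_tuple.
by have := rhoM (Ordinal rn); rewrite (tnth_nth 0%N).
Qed.

Lemma value_mkpat_pattern G i r : is_pattern K.+1 n (nth 0%N rho) G ->
  (i < K.+2)%N -> value (mkpat K n M G) i r = G i r.
Proof.
move=> pG iK; have [rn|nr] := ltnP r n; last by rewrite value_out // (pattern_out pG).
by rewrite value_mkpat // (leq_trans (is_pattern_bound r pG _) (nth_bound r)).
Qed.

Lemma mkpat_pattern G : is_pattern K.+1 n (nth 0%N rho) G ->
  pattern rho (mkpat K n M G).
Proof.
move=> pG; have E i r := @value_mkpat_pattern G i r pG; apply/patternP; case: pG => p0 pN po le il.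
split=> [r|r|i r nr|i r iK|i r iK].
- by rewrite E.
- by rewrite E.
- exact: value_out.
- by rewrite !E ?ltnS ?(ltnW iK) //; exact: le.
- by rewrite !E ?ltnS ?(ltnW iK) //; exact: il.
Qed.

Variable k : nat.
Hypothesis kK : (k.+1 < K.+1)%N.

Definition toggle_pat g : pat := mkpat K n M (toggle k (value g)).

Lemma toggle_pat_pattern g : pattern rho g -> pattern rho (toggle_pat g).
Proof. by move=> /patternP pg; apply: mkpat_pattern; apply: toggle_pattern. Qed.

Lemma value_toggle_pat g i r : pattern rho g -> (i < K.+2)%N ->
  value (toggle_pat g) i r = toggle k (value g) i r.
Proof.
by move=> /patternP pg iK; apply: value_mkpat_pattern => //; apply: toggle_pattern.
Qed.

Lemma toggle_patK g : pattern rho g -> toggle_pat (toggle_pat g) = g.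
Proof.
move=> pg; have pg' := toggle_pat_pattern pg; apply: value_inj => i r iK rn.
rewrite value_toggle_pat // -[RHS](toggleK kK i r (elimT (patternP _ _) pg)).
have E j : (j < K.+2)%N -> value (toggle_pat g) j =1 toggle k (value g) j.
  by move=> jK s; exact: value_toggle_pat.
rewrite {1 2}/toggle; case: eqP => [_|_]; last exact: E.
rewrite /toggle_max /toggle_min; have k2 : (k.+2 < K.+2)%N by [].
by case: r {rn} => [|r]; rewrite !E // ?(ltnW k2) ?(ltnW (ltnW k2)).
Qed.

Lemma level_toggle_pat g i : pattern rho g -> (i < K.+2)%N -> i != k.+1 ->
  level (toggle_pat g) i = level g i.
Proof.
move=> pg iK nik; apply: eq_bigr => r _.
by rewrite value_toggle_pat // /toggle (negbTE nik).
Qed.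

Lemma level_toggle_pat_add g : pattern rho g ->
  (level (toggle_pat g) k.+1 + level g k.+1 = level g k.+2 + level g k)%N.
Proof.
move=> pg; rewrite -(toggle_sum kK (elimT (patternP _ _) pg)); congr addn.
by apply: eq_bigr => r _; rewrite value_toggle_pat // ltnW.
Qed.

(** Levels [k] and [k.+2] stay, and the old and new levels [k.+1] add up to their sum, so the two
    consecutive differences trade places. *)
Lemma content_toggle_pat g (a b : 'I_K.+1) : pattern rho g ->
  a = k :> nat -> b = k.+1 :> nat ->
  content (toggle_pat g) = [multinom content g (tperm a b i) | i < K.+1].
Proof.
move=> pg ak bk; apply/mnmP => i; rewrite !mnmE.
have pg' := toggle_pat_pattern pg.
have add := level_toggle_pat_add pg.
have L0 := level_toggle_pat pg (ltnW (ltnW kK)).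
have L2 := level_toggle_pat pg (kK : (k.+2 < K.+2)%N).
have l0 := level_le pg (ltnW kK); have l1 := level_le pg kK.
have l0' := level_le pg' (ltnW kK); have l1' := level_le pg' kK.
rewrite L0 ?ltn_eqF // in l0'; rewrite L2 ?gtn_eqF // in l1'.
case: tpermP => [->|->|/eqP nia /eqP nib].
- rewrite ak bk L0 ?ltn_eqF //; lia.
- rewrite ak bk L2 ?gtn_eqF //; lia.
- move: nia nib; rewrite -!val_eqE /= ak bk => nia nib.
  by rewrite !level_toggle_pat ?eqSS // ltnS ?ltn_ord // ltnW ?ltn_ord.
Qed.

(** Reindexing the sum over patterns by the involution [toggle_pat] has the effect of the
    transposition on exponents. *)
Lemma schur_msym_tperm (R : comNzRingType) (a b : 'I_K.+1) :
  a = k :> nat -> b = k.+1 :> nat ->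
  msym (tperm a b) (schur R K.+1 rho) = schur R K.+1 rho.
Proof.
move=> ak bk; rewrite (schur_patterns K rho_part rhoM) raddf_sum /=.
rewrite [RHS](reindex_onto toggle_pat toggle_pat); last exact: toggle_patK.
apply: eq_big => [g|g pg]; last by rewrite msymX tpermV (content_toggle_pat pg ak bk).
apply/idP/andP => [pg|[pg /eqP <-]]; last exact: toggle_pat_pattern.
by rewrite toggle_patK // eqxx toggle_pat_pattern.
Qed.

End Symmetry.

(** * Wronskians, Euler's identity and sign-reversing involutions *)

Lemma mpoly_XM_mderivX (R : comNzRingType) N (i : 'I_N) (m : 'X_{1..N}) :
  'X_i * 'X_[m]^`M(i) = (m i)%:R *: 'X_[m] :> {mpoly R[N]}.
Proof.
rewrite mderivX -scalerAr -mpolyXD; case: (posnP (m i)) => [->|mi].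
  by rewrite !scale0r.
by rewrite addmC submK // lep1mP -lt0n.
Qed.

Lemma mderiv_msym (R : comNzRingType) N (s : 'S_N) (i : 'I_N) (p : {mpoly R[N]}) :
  (msym s p)^`M(s i) = msym s p^`M(i).
Proof.
apply/mpolyP => m; rewrite mcoeff_sym !mcoeff_deriv mcoeff_sym mnmE.
congr (_@_ _ *+ _); apply/mnmP => j.
by rewrite !mnmE (inj_eq perm_inj).
Qed.

Definition wronskian (R : comNzRingType) N (f g : {mpoly R[N]}) (i : 'I_N) :=
  g * f^`M(i) - f * g^`M(i).

Lemma wronskian_msym (R : comNzRingType) N (f g : {mpoly R[N]}) (s : 'S_N) i :
  msym s f = f -> msym s g = g ->
  wronskian f g (s i) = msym s (wronskian f g i).
Proof.
by move=> sf sg; rewrite /wronskian msymB !msymM -!mderiv_msym sf sg.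
Qed.

(** Both sums are homogeneous, of degrees [a] and [b], so Euler's identity applies to each. *)
Lemma sum_wronskian (R : comNzRingType) N (I J : finType) (P : pred I) (Q : pred J)
    (c : I -> 'X_{1..N}) (d : J -> 'X_{1..N}) (a b : nat) :
  (forall u, P u -> mdeg (c u) = a) -> (forall v, Q v -> mdeg (d v) = b) ->
  let f : {mpoly R[N]} := \sum_(u | P u) 'X_[c u] in
  let g : {mpoly R[N]} := \sum_(v | Q v) 'X_[d v] in
  \sum_i 'X_i * wronskian f g i = (a%:R - b%:R) *: (f * g).
Proof.
have euler (L : finType) (S : pred L) (e : L -> 'X_{1..N}) t :
    (forall u, S u -> mdeg (e u) = t) ->
    \sum_i 'X_i * (\sum_(u | S u) 'X_[e u] : {mpoly R[N]})^`M(i) =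
    t%:R *: \sum_(u | S u) 'X_[e u].
  move=> et; under eq_bigr do rewrite raddf_sum mulr_sumr.
  rewrite exchange_big scaler_sumr; apply: eq_bigr => u Su /=.
  under eq_bigr do rewrite mpoly_XM_mderivX.
  by rewrite -scaler_suml -natr_sum -mdegE et.
move=> Pa Qb f g; have /esym Ef := euler _ _ c a Pa; have /esym Eg := euler _ _ d b Qb.
rewrite scalerBl {1}scalerAl Ef scalerAr Eg mulr_suml mulr_sumr -sumrB.
apply: eq_bigr => i _; rewrite /wronskian -/f -/g mulrBr.
by congr (_ - _); [rewrite [g * _]mulrC mulrA|rewrite mulrCA].
Qed.

(** [phi] pairs each positive term with its own negative; the unpaired terms are nonpositive.
    Nothing is asked of [phi] where the weight is not positive. *)
Lemma sum_le0_by_involution (R : realDomainType) (T : finType) (D : pred T)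
    (w : T -> R) (phi : T -> T) :
  (forall p, D p -> 0 < w p -> [/\ D (phi p), w (phi p) = - w p & phi (phi p) = p]) ->
  \sum_(p | D p) w p <= 0.
Proof.
move=> phiP; rewrite (bigID (fun p => 0 < w p)) /=.
pose S p := D p && (0 < w p).
(* [B] is the image under [phi] of the set [S] of positive terms. *)
pose B p := [&& D p, ~~ (0 < w p), S (phi p) & phi (phi p) == p].
have le_B : \sum_(p | D p && ~~ (0 < w p)) w p <= \sum_(p | B p) w p.
  rewrite (bigID (fun p => S (phi p) && (phi (phi p) == p))) /=.
  rewrite (eq_bigl B) => [|p]; last by rewrite -andbA.
  rewrite gerDl; apply: sumr_le0 => p /andP[/andP[_ wp] _].
  by rewrite leNgt.
apply: le_trans (lerD (lexx _) le_B) _.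
rewrite [X in _ + X](reindex_onto phi phi) => [|p /and4P[_ _ _ /eqP]//].
rewrite [X in _ + X](eq_big S (fun p => - w p)).
- by rewrite sumrN subrr.
- move=> p; apply/andP/idP => [[/and4P[_ _ Sp _] /eqP E]|Sp]; first by rewrite -E.
  have /andP[Dp wp] := Sp; have [Dq wq E] := phiP p Dp wp.
  by rewrite /B E Sp Dq wq oppr_gt0 -leNgt ltW // !eqxx.
- move=> p /andP[/and4P[_ _ Sp _] /eqP E]; rewrite E in Sp.
  by have /andP[Dp wp] := Sp; have [_ ->] := phiP p Dp wp.
Qed.

(** * Cell transfer and the sign of the first Wronskian *)

Section CellTransfer.

Variables (K n M : nat) (lambda rho : n.-tuple nat).
Hypothesis n_gt0 : (0 < n)%N.
Hypothesis le_lr : forall i, (tnth lambda i <= tnth rho i)%N.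
Local Notation pat := {ffun 'I_K.+2 * 'I_n -> 'I_M.+1}.
Implicit Types P Q : pat.

(* The value of a pattern here is the number of entries equal to 0: by
   interlacing, these all lie in row 0. *)
Let v0 : 'I_K.+2 * 'I_n := (lift ord0 ord0, Ordinal n_gt0).
Local Notation transfer := (swap (@pat_rel K n) v0).

Lemma content_ord0 (mu : n.-tuple nat) P : pattern mu P -> content P ord0 = P v0.
Proof.
move=> /patternP pP; rewrite mnmE /level /= [X in (_ - X)%N]big1 => [|r _];
  last exact: (pattern0 pP).
rewrite subn0 (bigD1 (Ordinal n_gt0)) //= big1 => [|[[|r] rn] //= _].
  by rewrite addn0 -valueE.
by have := pattern_interlace pP r (ltn0Sn _); rewrite (pattern0 pP) leqn0 => /eqP.
Qed.

Lemma swap_pattern P Q : pattern lambda P -> pattern rho Q -> (Q v0 < P v0)%N ->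
  pattern lambda (transfer P Q) && pattern rho (transfer Q P).
Proof.
move=> /andP[mP /forallP bP] /andP[mQ /forallP bQ] lt0.
have add u := swap_add (@pat_rel K n) v0 P Q u.
(* Where [P <= Q], [swap_fixed] preserves [P], and conservation of the sum then preserves [Q]. *)
have fix_ u : (P u <= Q u)%N -> (transfer P Q u = P u) /\ (transfer Q P u = Q u).
  by move=> le; have := add u; rewrite (swap_fixed mP mQ lt0 le) => /addnI /val_inj.
apply/andP; split; apply/andP; split; rewrite ?swap_monotone //.
  apply/forallP => r; have /andP[/eqP P0 /eqP PN] := bP r.
  have /andP[/eqP Q0 /eqP QN] := bQ r.
  have [|-> _] := fix_ (ord0, r); first by rewrite P0 Q0.
  have [|-> _] := fix_ (ord_max, r); first by rewrite PN QN.
  by rewrite P0 PN !eqxx.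
apply/forallP => r; have /andP[/eqP P0 /eqP PN] := bP r.
have /andP[/eqP Q0 /eqP QN] := bQ r.
have [|_ ->] := fix_ (ord0, r); first by rewrite P0 Q0.
have [|_ ->] := fix_ (ord_max, r); first by rewrite PN QN.
by rewrite Q0 QN !eqxx.
Qed.

Lemma level_swap P Q i :
  (level (transfer P Q) i + level (transfer Q P) i =
   level P i + level Q i)%N.
Proof.
rewrite /level -!big_split /=; apply: eq_bigr => r _.
have [iK|iK] := ltnP i K.+2; first by rewrite !(value_nat _ iK (ltn_ord r)) swap_add.
by rewrite /value insubN // -leqNgt.
Qed.

(** Level sums are conserved, and all four level sequences are increasing, so no subtraction in the
    contents truncates. *)
Lemma content_swap P Q : pattern lambda P -> pattern rho Q -> (Q v0 < P v0)%N ->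
  (content (transfer P Q) + content (transfer Q P) =
   content P + content Q)%MM.
Proof.
move=> pP pQ lt0; have /andP[pP' pQ'] := swap_pattern pP pQ lt0.
apply/mnmP => i; rewrite !mnmDE !mnmE.
have := level_swap P Q i; have := level_swap P Q i.+1.
have := level_le pP (ltn_ord i); have := level_le pQ (ltn_ord i).
have := level_le pP' (ltn_ord i); have := level_le pQ' (ltn_ord i).
lia.
Qed.

Lemma wronskian_patterns_le0 (R : realDomainType) (m : 'X_{1..K.+1}) :
  (wronskian (\sum_(P : pat | pattern lambda P) 'X_[content P])
             (\sum_(Q : pat | pattern rho Q) 'X_[content Q] : {mpoly R[K.+1]}) ord0)@_m <= 0.
Proof.
set f := \sum_(P | _) _; set g := \sum_(Q | _) _.
pose wt (p : pat * pat) : R := (p.1 v0)%:R - (p.2 v0)%:R.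
have -> : (wronskian f g ord0)@_m =
    \sum_(p : pat * pat | [&& pattern lambda p.1, pattern rho p.2 &
        (content p.1 + content p.2 == U_(ord0) + m)%MM]) wt p.
  (* Multiplying by the first variable turns its derivative into multiplication by the exponent, at
     the cost of shifting the monomial by [U_(ord0)]. *)
  rewrite -(mcoeffMX _ U_(ord0)).
  have -> : wronskian f g ord0 * 'X_ord0 =
     \sum_(P | pattern lambda P) \sum_(Q | pattern rho Q)
        wt (P, Q) *: 'X_[(content P + content Q)%MM].
    have deriv (mu : n.-tuple nat) :
      'X_ord0 * (\sum_(P : pat | pattern mu P) 'X_[content P] : {mpoly R[K.+1]})^`M(ord0) =
      \sum_(P : pat | pattern mu P) (P v0)%:R *: 'X_[content P].
      rewrite raddf_sum mulr_sumr; apply: eq_bigr => P pP.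
      by rewrite mpoly_XM_mderivX (content_ord0 pP).
    rewrite mulrC /wronskian mulrBr mulrCA deriv [X in _ - X]mulrCA deriv.
    rewrite [X in X - _]mulrC !big_distrlr /= -sumrB; apply: eq_bigr => P _.
    rewrite -sumrB; apply: eq_bigr => Q _.
    by rewrite -scalerAl -scalerAr -mpolyXD -scalerBl.
  rewrite pair_big /= raddf_sum /= big_mkcond /= [RHS]big_mkcond /=.
  apply: eq_bigr => -[P Q] _ /=; rewrite andbA; case: (_ && _) => //=.
  by rewrite mcoeffZ mcoeffX; case: eqP; rewrite (mulr1, mulr0).
apply: (@sum_le0_by_involution _ _ _ _
  (fun p => (transfer p.1 p.2, transfer p.2 p.1))).
move=> [P Q] /= /and3P[pP pQ /eqP cPQ]; rewrite /wt /= subr_gt0 ltr_nat => lt0.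
have /andP[pP' pQ'] := swap_pattern pP pQ lt0.
have [mP _] := andP pP; have [mQ _] := andP pQ.
split; first by rewrite pP' pQ' content_swap // cPQ eqxx.
  by rewrite !swap_root opprB.
by rewrite !swapK.
Qed.

End CellTransfer.

(** * Transport of Wronskians between variables *)

(** Adjacent transpositions fix [f] and [g] and carry index 0 to [j] one step at a time. *)
Lemma wronskian_orbit (R : comNzRingType) (K : nat) (f g : {mpoly R[K.+1]}) :
  (forall a b : 'I_K.+1, b = a.+1 :> nat ->
     msym (tperm a b) f = f /\ msym (tperm a b) g = g) ->
  forall j, exists s, wronskian f g j = msym s (wronskian f g ord0).
Proof.
move=> sym [j jK]; elim: j jK => [|j IH] jK.
  by exists 1%g; rewrite msym1m; congr wronskian; apply: val_inj.
have [s Es] := IH (ltnW jK); have [sf sg] := sym (Ordinal (ltnW jK)) (Ordinal jK) erefl.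
exists (s * tperm (Ordinal (ltnW jK)) (Ordinal jK))%g.
by rewrite msymMm -Es -wronskian_msym // tpermL.
Qed.

(** * Signs of coefficients and of values at positive points *)

Section Positivity.

Variables (R : realDomainType) (N : nat).
Implicit Types p q : {mpoly R[N]}.

Lemma schur_coeff_ge0 n (rho : n.-tuple nat) m : 0 <= (schur R N rho)@_m.
Proof.
rewrite /schur raddf_sum; apply: sumr_ge0 => T _ /=.
by rewrite -(big_morph _ (@mpolyXD _ R) (mpolyX0 _ R)) mcoeffX ler0n.
Qed.

Lemma mcoeffM_ge0 p q : (forall m, 0 <= p@_m) -> (forall m, 0 <= q@_m) ->
  forall m, 0 <= (p * q)@_m.
Proof. by move=> p0 q0 m; rewrite mcoeffM; apply: sumr_ge0 => k _; apply: mulr_ge0. Qed.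

Lemma schur_meval_gt0 n (rho : n.-tuple nat) (x : 'I_N -> R) :
  (n <= N)%N -> (forall i, 0 < x i) -> 0 < (schur R N rho).@[x].
Proof.
move=> nN x_gt0; rewrite /schur raddf_sum /=.
have term (T : {ffun box rho -> 'I_N}) : 0 < (\prod_b 'X_(T b)).@[x].
  by rewrite rmorph_prod /=; apply: prodr_gt0 => b _; rewrite mevalXU.
(* A witness that the sum is nonempty: row [i] is filled with [i], which is possible since
   [n <= N]. *)
pose T0 := [ffun b : box rho => widen_ord nN (tag b)].
have T0P : is_ssyt T0.
  apply/forallP => b; apply/forallP => c; rewrite !ffunE /=; apply/andP; split.
    by apply/implyP => /andP[/eqP E _]; rewrite /box_row in E; rewrite E.
  by apply/implyP => /andP[].
rewrite (bigD1 T0) //=; apply: ltr_pwDl => //; apply: sumr_ge0 => T _; exact: ltW.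
Qed.

Lemma meval_lt0 p (x : 'I_N -> R) : p != 0 -> (forall m, p@_m <= 0) ->
  (forall i, 0 < x i) -> p.@[x] < 0.
Proof.
move=> p_neq0 p_le0 x_gt0; rewrite mevalE.
have term m : m \in msupp p -> p@_m * \prod_i x i ^+ m i < 0.
  rewrite mcoeff_msupp => pm; rewrite nmulr_rlt0; last by rewrite lt_neqAle pm p_le0.
  by apply: prodr_gt0 => i _; apply: exprn_gt0.
have := p_neq0; rewrite -msupp_eq0; move: (msupp p) term => [//|m s] term _.
rewrite big_cons; apply: ltr_nwDl; first by apply: term; rewrite mem_head.
rewrite big_seq; apply: sumr_le0 => k ks; apply/ltW/term.
by rewrite in_cons ks orbT.
Qed.

End Positivity.

(** * The Wronskians of two nested Schur polynomials *)

Section SchurWronskian.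

Variables (R : realDomainType) (K n : nat) (lambda rho : n.-tuple nat).
Hypothesis n_gt0 : (0 < n)%N.
Hypothesis nK : (n <= K.+1)%N.
Hypothesis lambda_part : is_partition lambda.
Hypothesis rho_part : is_partition rho.
Hypothesis le_lr : forall i, (tnth lambda i <= tnth rho i)%N.

Let f : {mpoly R[K.+1]} := schur R K.+1 lambda.
Let g : {mpoly R[K.+1]} := schur R K.+1 rho.
(** A common bound on the rows of both shapes, so that their patterns share one type and can be
    exchanged. *)
Let M := (\sum_(i < n) tnth rho i)%N.

Lemma rho_bound i : (tnth rho i <= M)%N.
Proof. by rewrite /M (bigD1 i) //= leq_addr. Qed.

Lemma lambda_bound i : (tnth lambda i <= M)%N.
Proof. exact: leq_trans (le_lr i) (rho_bound i). Qed.

Lemma schur_wronskian_orbit j : exists s, wronskian f g j = msym s (wronskian f g ord0).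
Proof.
apply: wronskian_orbit => a b ab; have aK : (a.+1 < K.+1)%N by rewrite -ab.
split; first exact: (schur_msym_tperm lambda_part lambda_bound aK).
exact: (schur_msym_tperm rho_part rho_bound aK).
Qed.

Lemma schur_wronskian_le0 j m : (wronskian f g j)@_m <= 0.
Proof.
have [s ->] := schur_wronskian_orbit j; rewrite mcoeff_sym.
rewrite /f /g (schur_patterns K lambda_part lambda_bound) (schur_patterns K rho_part rho_bound).
exact: wronskian_patterns_le0.
Qed.

Lemma sum_schur_wronskian :
  \sum_j 'X_j * wronskian f g j = (#|box lambda|%:R - #|box rho|%:R) *: (f * g).
Proof.
have deg (mu : n.-tuple nat) (T : {ffun box mu -> 'I_K.+1}) :
    is_ssyt T -> mdeg (\sum_(b : box mu) U_(T b))%MM = #|box mu|.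
  by move=> _; rewrite mdeg_sum; under eq_bigr do rewrite mdeg1; rewrite sum1_card.
rewrite /f /g !schur_monomials; exact: sum_wronskian (@deg lambda) (@deg rho).
Qed.

Hypothesis lt_lr : exists i, (tnth lambda i < tnth rho i)%N.

Lemma card_box_lt : (#|box lambda| < #|box rho|)%N.
Proof.
have card (mu : n.-tuple nat) : #|box mu| = (\sum_(i < n) tnth mu i)%N.
  transitivity (\sum_(i < n) \sum_(c < tnth mu i) 1)%N.
    by rewrite sig_big_dep sum1_card.
  by apply: eq_bigr => i _; rewrite sum1_card card_ord.
have [i lti] := lt_lr; rewrite !card (bigD1 i) //= [X in (_ < X)%N](bigD1 i) //=.
by rewrite -addSn leq_add // leq_sum.
Qed.

Lemma schur_neq0 (mu : n.-tuple nat) : schur R K.+1 mu != 0.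
Proof.
apply/eqP => mu0; have := schur_meval_gt0 (R := R) mu (x := fun=> 1) nK (fun=> ltr01).
by rewrite mu0 meval0 ltxx.
Qed.

(** If one Wronskian vanished, all would by symmetry, and Euler's identity would make a product of
    nonzero factors vanish, the shapes having different sizes. *)
Lemma schur_wronskian_neq0 j : wronskian f g j != 0.
Proof.
have W0 : wronskian f g ord0 != 0.
  apply/eqP => W0; have /esym/eqP := sum_schur_wronskian.
  rewrite big1 => [|i _]; last first.
    by have [s ->] := schur_wronskian_orbit i; rewrite W0 raddf0 mulr0.
  rewrite -mul_mpolyC !mulf_eq0 mpolyC_eq0 !(negbTE (schur_neq0 _)) !orbF subr_eq0 eqr_nat.
  by rewrite ltn_eqF // card_box_lt.
have [s ->] := schur_wronskian_orbit j.
by apply: contra W0 => /eqP E; rewrite -(inj_eq (inj_msym s)) E raddf0.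
Qed.

End SchurWronskian.

(** * Partial derivatives as derivatives along coordinate lines *)

Section Derivative.

Variables (R : realType) (N : nat).
Implicit Types (p : {mpoly R[N]}) (x : 'I_N -> R).

Lemma meval_setcoordX x j t (m : 'X_{1..N}) :
  'X_[m].@[setcoord x j t] = t ^+ m j * \prod_(i | i != j) x i ^+ m i.
Proof.
rewrite mevalX (bigD1 j) //= /setcoord eqxx; congr (_ * _).
by apply: eq_bigr => i /negbTE ->.
Qed.

Lemma is_derive_meval p x (j : 'I_N) (t : R) :
  is_derive t (1 : R) (fun u : R => p.@[setcoord x j u]) (p^`M(j).@[setcoord x j t]).
Proof.
elim/mpolyind: p => [|c m p _ _ IH].
  rewrite mderiv0 meval0 (_ : (fun _ => _) = cst 0); first exact: is_derive_cst.
  by apply/funext => u; rewrite meval0.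
(* Along the line only coordinate [j] moves, so the monomial is a constant times a power of [u]; [C]
   collects the other variables. *)
set C := \prod_(i | i != j) x i ^+ m i.
pose q := (c * C) *: 'X^(m j) : {poly R}.
rewrite (_ : (fun _ => _) = horner q + (fun u => p.@[setcoord x j u])); last first.
  apply/funext => u; rewrite mevalD mevalZ meval_setcoordX -/C /=.
  by rewrite fctE /q hornerZ hornerXn [_ * C]mulrC mulrA.
apply: is_derive_eq; rewrite mderivD mderivZ mderivX mevalD !mevalZ meval_setcoordX.
congr (_ + _); rewrite mnmBE mnm1E eqxx subn1.
rewrite [in RHS](eq_bigr (fun i => x i ^+ m i)) -/C; last first.
  by move=> i ij; rewrite mnmBE mnm1E eq_sym (negbTE ij) subn0.
by rewrite /q derivZ derivXn hornerZ hornerMn hornerXn -mulr_natl; ring.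
Qed.

Lemma is_derive_ratio (p q : {mpoly R[N]}) x j t : q.@[setcoord x j t] != 0 ->
  is_derive t (1 : R) (fun u : R => p.@[setcoord x j u] / q.@[setcoord x j u])
    ((wronskian p q j).@[setcoord x j t] / (q ^+ 2).@[setcoord x j t]).
Proof.
move=> q_neq0; have dp := is_derive_meval p x j t; have dq := is_derive_meval q x j t.
have dV := is_deriveV q_neq0 dq.
apply: is_derive_eq; rewrite /wronskian mevalB !mevalM.
by rewrite /GRing.scale /= expr2; field.
Qed.

End Derivative.

(** * Strict decrease of the ratio and the signed form of its derivative *)

Unset Implicit Arguments.

Theorem theoremA (R : realType) (n N : nat) (hn : (1 <= n)%N) (hnN : (n <= N)%N)
    (lambda rho : n.-tuple nat)
    (hlambda : is_partition lambda) (hrho : is_partition rho)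
    (hle : forall i : 'I_n, (tnth lambda i <= tnth rho i)%N)
    (hlt : exists i : 'I_n, (tnth lambda i < tnth rho i)%N) :
  (forall (j : 'I_N) (x : 'I_N -> R), (forall i, 0 < x i) ->
     forall s t : R, 0 < s -> s < t ->
       schur_ratio lambda rho (setcoord x j t)
       < schur_ratio lambda rho (setcoord x j s))
  /\
  (forall j : 'I_N, exists p q : {mpoly R[N]},
     [/\ q != 0,
         (forall m : 'X_{1..N}, 0 <= q@_m),
         (forall m : 'X_{1..N}, p@_m <= 0)
       & forall x : 'I_N -> R,
           (schur R N rho).@[x] != 0 -> q.@[x] != 0 ->
           is_derive (x j) (1 : R)
             (fun t : R => schur_ratio lambda rho (setcoord x j t))
             (p.@[x] / q.@[x])]).
Proof.
case: N hnN => [|K] nK; first by rewrite leqNgt hn in nK.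
pose f : {mpoly R[K.+1]} := schur R K.+1 lambda.
pose g : {mpoly R[K.+1]} := schur R K.+1 rho.
have W_le0 j m : (wronskian f g j)@_m <= 0 by apply: schur_wronskian_le0.
have W_neq0 j : wronskian f g j != 0 by apply: schur_wronskian_neq0.
split=> [j x x_gt0 s t s_gt0 lt_st|j].
  have y_gt0 u : s <= u -> forall i, 0 < setcoord x j u i.
    by move=> su i; rewrite /setcoord; case: eqP => // _; apply: lt_le_trans su.
  pose F u := schur_ratio lambda rho (setcoord x j u).
  have dF u : s <= u -> is_derive u (1 : R) F
      ((wronskian f g j).@[setcoord x j u] / (g ^+ 2).@[setcoord x j u]).
    move=> su; apply: is_derive_ratio; rewrite gt_eqF //.
    exact/schur_meval_gt0/y_gt0.
  have dF' u : s <= u -> derivable F u 1 by move=> /dF[].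
  apply: (@ltr0_derive1_lt_cc _ F s t); rewrite ?in_itv /= ?lexx ?(ltW lt_st) //.
  - by move=> u; rewrite in_itv /= => /andP[/ltW su _]; apply: dF'.
  - move=> u; rewrite in_itv /= => /andP[/ltW su _]; rewrite derive1E.
    (* The Wronskian is nonzero with nonpositive coefficients, hence negative at positive points,
       while the denominator is a positive square. *)
    have [_ ->] := dF u su; rewrite pmulr_llt0.
      by apply: meval_lt0 => //; apply: y_gt0.
    by rewrite invr_gt0 rmorphXn exprn_gt0 //; apply/schur_meval_gt0/y_gt0.
  - apply: derivable_within_continuous => u; rewrite in_itv /= => /andP[su _].
    exact: dF'.
(* The quotient rule supplies both witnesses, left unreduced. *)
exists (wronskian f g j), (g ^+ 2); split=> //.
- by rewrite expf_neq0 // schur_neq0.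
- by apply: mcoeffM_ge0; apply: schur_coeff_ge0.
move=> x gx _.
have setx : setcoord x j (x j) =1 x by move=> i; rewrite /setcoord; case: eqP => [->|].
rewrite -!(meval_eq _ setx); apply: is_derive_ratio.
by rewrite (meval_eq _ setx).
Qed.
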